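(* Let $\mathbf{a}=(a_0,a_1,a_2,\ldots)$ be the increasing sequence of all $n\in\mathbb{N}$ such that $\binom{2n}{n}\equiv 1\pmod 3$. Let $\mathbf{t}=(t_0,t_1,\ldots)=(0,1,1,0,1,0,0,1,\ldots)$ be the Thue–Morse sequence, i.e. $t_i$ is the remainder on division by $2$ of the number of ones in the binary expansion of $i$. Then $a_i\equiv t_i\pmod 3$ for all $i\in\mathbb{N}$.
   Context: Equivalently, the Thue–Morse sequence is defined by $t_0=0$, $t_{2i}=t_i$, $t_{2i+1}=1-t_i$. *)

(* Defs.v *)
From mathcomp Require Import all_boot.

Set Implicit Arguments.
Unset Strict Implicit.
Unset Printing Implicit Defensive.

(* The k-th binary digit of i is odd (i %/ 2 ^ k); since i < 2 ^ i, all digits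
   at positions k >= i are zero, so the bound k < i loses none of them. *)
Definition binary_ones (i : nat) : nat := \sum_(k < i) odd (i %/ 2 ^ k).

Definition thue_morse (i : nat) : nat := binary_ones i %% 2.

(* The sequence a enumerates, in increasing order, exactly the naturals
   satisfying P. *)
Definition increasing_enumeration (P : nat -> Prop) (a : nat -> nat) : Prop :=
  (forall i j : nat, i < j -> a i < a j) /\
  (forall n : nat, P n <-> exists i : nat, a i = n).

(* Main.v *)
Require Import Defs.
From mathcomp Require Import all_boot.
From mathcomp Require Import zify.

Set Implicit Arguments.
Unset Strict Implicit.
Unset Printing Implicit Defensive.

(** Let [b j] be the number obtained by reading the binary digits of [j] in base
    3. By Lucas, [C(2n, n)] vanishes mod 3 unless all ternary digits of [n] are 0
    or 1, i.e. unless [n = b j] for some [j], and then it is [2] to the number of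
    ones of [j]. So the [n] with [C(2n, n) = 1] are the [b j] with [j] having
    evenly many ones; these [j] are exactly the [2 i + t_i]. Since [b] is
    increasing, [a_i = b (2 i + t_i) = 3 b i + t_i]. *)

(** In Vandermonde's sum over ['C(p, j) * 'C(m, k - j)], the prime [p] divides every term except
    those at [j = 0] and [j = p]. *)
Lemma binDp p m k : prime p ->
  'C(p + m, k) = 'C(m, k) + (p <= k) * 'C(m, k - p) %[mod p].
Proof.
move=> pr_p; have p_gt0 := prime_gt0 pr_p.
rewrite -Vandermonde big_ord_recl bin0 mul1n subn0 -[LHS]modnDmr -[RHS]modnDmr.
congr ((_ + _) %% p).
have dvd_inner (j : 'I_k) : j.+1 != p -> p %| 'C(p, j.+1) * 'C(m, k - j.+1).
  move=> neq_jp; case: (ltnP j.+1 p) => lt_jp.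
    by rewrite dvdn_mulr // prime_dvd_bin.
  by rewrite bin_small ?dvdn0 // ltn_neqAle eq_sym neq_jp.
have [le_pk | lt_kp] := leqP p k; last first.
  rewrite mul0n mod0n; apply/eqP/dvdn_sum => j _; apply: dvd_inner.
  by rewrite neq_ltn (leq_ltn_trans (ltn_ord j) lt_kp).
have lt_p1k : p.-1 < k by rewrite prednK.
(* Splitting off [j = 0] shifted the indices by one, so the term for [p] sits at [p.-1]. *)
rewrite (bigD1 (Ordinal lt_p1k)) //= /bump /= add1n prednK // binn.
rewrite -modnDmr; set s := \sum_(_ | _) _.
suff /eqP -> : p %| s by rewrite addn0.
apply: dvdn_sum => j neq_j; apply: dvd_inner.
by apply: contraNneq neq_j => eq_jp; rewrite -val_eqE /= -eq_jp.
Qed.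

(** Induction on [m]: taking one [p] off the top by [binDp] turns into Pascal's rule for
    ['C(m.+1, k.+1)]. *)
Lemma lucas p m k r s : prime p -> r < p -> s < p ->
  'C(p * m + r, p * k + s) = 'C(m, k) * 'C(r, s) %[mod p].
Proof.
move=> pr_p lt_rp lt_sp; elim: m k => [|m IHm] [|k].
- by rewrite !muln0 !add0n bin0 mul1n.
- rewrite muln0 add0n bin0n mul0n bin_small //.
  by rewrite mulnS -addnA ltn_addr.
- rewrite mulnS -addnA binDp // muln0 add0n leqNgt lt_sp mul0n addn0.
  by have := IHm 0; rewrite muln0 add0n !bin0.
rewrite mulnS -addnA binDp // mulnS -addnA leq_addr mul1n addKn.
by rewrite addnA -mulnS -modnDm !IHm modnDm binS mulnDl.
Qed.

Definition central_mod3 n := 'C(2 * n, n) %% 3.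

Lemma central_mod3_step n d : d < 3 ->
  central_mod3 (3 * n + d) = (if d == 2 then 0 else d.+1 * central_mod3 n) %% 3.
Proof.
rewrite /central_mod3; case: d => [|[|[|]]] // _ /=.
- by rewrite (_ : 2 * _ = 3 * (2 * n) + 0) ?lucas ?muln1 ?mul1n ?modn_mod //; lia.
- rewrite (_ : 2 * _ = 3 * (2 * n) + 2); last lia.
  by rewrite lucas // modnMmr mulnC.
(* Doubling the digit 2 carries and leaves the digit 1, giving the factor ['C(1, 2) = 0]. *)
rewrite (_ : 2 * _ = 3 * (2 * n).+1 + 1); last lia.
by rewrite lucas // muln0.
Qed.

(** A general [w] lets one recursion serve both the count of ones ([w = 1]) and the base-3 reading
    ([w = 3]). *)
Definition binary_digits_in_base w i := \sum_(k < i) odd (i %/ 2 ^ k) * w ^ k.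

Lemma binary_digits_widen w i m : i <= m ->
  \sum_(k < m) odd (i %/ 2 ^ k) * w ^ k = binary_digits_in_base w i.
Proof.
move=> le_im; rewrite /binary_digits_in_base.
rewrite (big_ord_widen m (fun k => odd (i %/ 2 ^ k) * w ^ k) le_im).
rewrite [RHS]big_mkcond; apply: eq_bigr => k _; case: ltnP => // le_ik.
by rewrite divn_small // (leq_trans (ltn_expl i (ltnSn 1))) // leq_exp2l.
Qed.

Lemma binary_digits_step w i :
  binary_digits_in_base w i = odd i + w * binary_digits_in_base w i./2.
Proof.
case: i => [|i]; first by rewrite /binary_digits_in_base !big_ord0 muln0.
rewrite {1}/binary_digits_in_base big_ord_recl expn0 divn1 muln1.
congr (_ + _); rewrite -(binary_digits_widen w (m := i)); last by lia.
rewrite big_distrr; apply: eq_bigr => k _ /=.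
by rewrite /bump /= add1n !expnS divnMA divn2 mulnCA.
Qed.

Lemma binary_digits_cons w (c : bool) i :
  binary_digits_in_base w (c + 2 * i) = c + w * binary_digits_in_base w i.
Proof.
by rewrite binary_digits_step mul2n half_bit_double oddD odd_double addbF oddb.
Qed.

Lemma binary_onesE i : binary_ones i = binary_digits_in_base 1 i.
Proof. by apply: eq_bigr => k _; rewrite exp1n muln1. Qed.

Lemma thue_morseE i : thue_morse i = odd (binary_digits_in_base 1 i).
Proof. by rewrite /thue_morse binary_onesE modn2. Qed.

Local Notation b := (binary_digits_in_base 3).

Lemma base3_incr : {homo b : i j / i < j}.
Proof.
move=> i j; elim/ltn_ind: j i => j IHj i lt_ij.
rewrite (binary_digits_step 3 i) (binary_digits_step 3 j).
have [lt_half | ge_half] := ltnP i./2 j./2.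
  by have := IHj j./2 ltac:(lia) i./2 lt_half; lia.
have -> : i./2 = j./2 by lia.
lia.
Qed.

(** Each digit 1 contributes a factor 2, which is -1 mod 3, so only the parity of the number of ones
    matters. *)
Lemma central_base3 j :
  central_mod3 (b j) = (odd (binary_digits_in_base 1 j)).+1.
Proof.
elim/ltn_ind: j => -[|j] IHj; first by rewrite /binary_digits_in_base !big_ord0.
rewrite (binary_digits_step 3) (binary_digits_step 1) addnC central_mod3_step.
  rewrite IHj; last by lia.
  by rewrite mul1n oddD oddb; case: (odd j.+1); case: (odd _).
by case: (odd j.+1).
Qed.

(** A last ternary digit 2 would give residue 0; otherwise that digit is a bit, and induction
    applies to the quotient. *)
Lemma central_neq0_base3 n : central_mod3 n != 0 -> exists j, b j = n.
Proof.
elim/ltn_ind: n => -[|n] IHn nz; first by exists 0; rewrite /b big_ord0.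
have def_n := divn_eq n.+1 3; set q := n.+1 %/ 3 in def_n.
have lt_d3 : n.+1 %% 3 < 3 by rewrite ltn_mod.
set d := n.+1 %% 3 in def_n lt_d3.
rewrite def_n mulnC central_mod3_step // in nz.
have [||j def_q] := IHn q; first by lia.
  by apply: contraNneq nz => ->; rewrite muln0 if_same mod0n.
have [c def_d] : exists c : bool, c = d :> nat.
  by case: d lt_d3 nz {def_n} => [|[|[|]]] // _ _; [exists false | exists true].
by exists (c + 2 * j); rewrite binary_digits_cons def_q def_d; lia.
Qed.

Lemma central1P n :
  'C(2 * n, n) = 1 %[mod 3] <-> exists i, 3 * b i + thue_morse i = n.
Proof.
rewrite -/(central_mod3 n); split=> [central1 | [i <-]].
  have [|j def_n] := @central_neq0_base3 n; first by rewrite central1.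
  move: central1; rewrite -def_n central_base3 (binary_digits_step 1) mul1n.
  rewrite oddD oddb; set t := binary_digits_in_base 1 _ => central1.
  (* Since [j] has evenly many ones, its last bit equals the parity of ones in [j./2]. *)
  exists j./2; rewrite thue_morseE -/t (binary_digits_step 3 j) addnC.
  by move: central1; case: (odd j); case: (odd t).
rewrite thue_morseE addnC -binary_digits_cons central_base3 binary_digits_cons.
by rewrite mul1n oddD oddb addbb.
Qed.

(** If [g i.+1 = f j], then [f i <= g i < f j] forces [i < j]. Applied in both directions, this
    identifies increasing sequences with equal range. *)
Lemma increasing_sub_range (f g : nat -> nat) :
    {homo f : i j / i < j} -> {homo g : i j / i < j} ->
    (forall i, exists j, f j = g i) -> forall i, f i <= g i.
Proof.
move=> f_incr g_incr sub_fg; have f_le := leq_mono f_incr.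
elim=> [|i IHi]; first by have [j <-] := sub_fg 0; rewrite f_le.
have [j def_g] := sub_fg i.+1; rewrite -def_g f_le -(leqW_mono f_le) def_g.
exact: leq_ltn_trans IHi (g_incr _ _ (ltnSn i)).
Qed.

Theorem theorem4p5 (a : nat -> nat)
    (ha : increasing_enumeration (fun n => 'C(2 * n, n) = 1 %[mod 3]) a)
    (i : nat) :
  a i = thue_morse i %[mod 3].
Proof.
have [a_incr a_range] := ha.
pose f i := 3 * b i + thue_morse i.
have f_incr : {homo f : i j / i < j}.
  (* Tripling makes the gap at least 3, while the Thue-Morse terms differ by at most 1. *)
  move=> j k /base3_incr lt_b; rewrite /f !thue_morseE.
  by case: (odd _); case: (odd _) => /=; lia.
suff -> : a i = f i by rewrite /f mulnC modnMDl.
apply/eqP; rewrite eqn_leq; apply/andP; split; apply: increasing_sub_range => //.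
  by move=> j; apply/a_range/central1P; exists j.
by move=> j; apply/central1P/a_range; exists j.
Qed.
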